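(* Let $G$ be a $q$-SSG with $r$ random vertices and $n$ MAX vertices. Then every run of the Generic Strategy Improvement Algorithm (GSIA) on $G$ performs at most $nq^{r}$ iterations. Here GSIA is: start from an arbitrary positional MAX strategy $\sigma$; while $(\sigma,\tau(\sigma))$ is not a pair of optimal strategies of $G$, choose any subset $A$ of the arcs of $G$, find any positional MAX strategy $\sigma'$ with $\sigma' \succ_{G[A,\sigma]} \sigma$, and set $\sigma\leftarrow\sigma'$; finally return $(\sigma,\tau(\sigma))$, $\tau(\sigma)$ being a positional best response to $\sigma$.
   Context: A simple stochastic game (SSG) $G$ is a finite directed graph whose vertex set is partitioned into MAX vertices, MIN vertices, random vertices and a nonempty set of sinks; every non-sink vertex has at least one outgoing arc, every sink has exactly one outgoing arc, a self-loop; each random vertex $x$ carries a rational probability distribution $p_x$ on its out-neighbourhood, positive on every out-neighbour; each sink $s$ has rational value $\mathrm{Val}(s)\in[0,1]$. A $q$-SSG is an SSG with exactly two sinks, of values $0$ and $1$, such that for every random vertex $x$ there is an integer $1\le q_x\le q$ with $p_x(x')=\ell_{x,x'}/q_x$ for natural numbers $\ell_{x,x'}$. A positional MAX (resp. MIN) strategy assigns to each MAX (resp. MIN) vertex one of its out-neighbours. Under $\sigma,\tau$ from start $x_0$, the random play moves from MAX vertex $x$ to $\sigma(x)$, from MIN vertex $x$ to $\tau(x)$, from random vertex $x$ to an out-neighbour drawn by $p_x$ independently, and stays at a sink once reached; its value is $\mathrm{Val}(s)$ if it reaches sink $s$, else $0$, and $v^G_{\sigma,\tau}(x_0)$ is its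 expectation. A best response to $\sigma$ is a positional MIN strategy $\tau$ with $v_{\sigma,\tau}\le v_{\sigma,\tau'}$ pointwise for all MIN strategies $\tau'$ (one exists); $v^G_\sigma:=v^G_{\sigma,\tau}$ for such $\tau$. A pair $(\sigma,\tau)$ is optimal if $\sigma$ maximises $v^G_\sigma$ pointwise over positional MAX strategies and $\tau$ is a best response to $\sigma$. Vectors are compared pointwise; $v>v'$ means $v\ge v'$ and $v\ne v'$. In a game $H$, $\sigma'\succ_H\sigma$ means $v^H_{\sigma'}>v^H_\sigma$ and, for every MAX vertex $x$ with $v^H_{\sigma'}(x)=v^H_\sigma(x)$, $\sigma'(x)=\sigma(x)$. Transformed game: $G[A,\sigma]$ is obtained from a copy of $G$ by replacing each arc $e=(x,y)\in A$ by an arc $(x,s_e)$ to a new sink $s_e$ of value $v^G_\sigma(y)$ (for random $x$, $p_x(s_e)=p_x(y)$); $y$ is kept. Strategies of $G$ and $G[A,\sigma]$ are identified, and value vectors of $G[A,\sigma]$ are compared only on vertices of $G$. *)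

(* Defs.v *)
From HB Require Import structures.
From mathcomp Require Import all_boot all_order all_algebra.
From mathcomp Require Import boolp classical_sets reals topology normedtype sequences.

Set Implicit Arguments. Unset Strict Implicit. Unset Printing Implicit Defensive.
Import Order.TTheory GRing.Theory Num.Theory numFieldNormedType.Exports.
Local Open Scope ring_scope.

Inductive vkind := VMax | VMin | VRand | VSink.

(* A (candidate) stochastic game on the finite vertex type V:
   vertex kinds, arcs, probabilities p_x(y) (relevant for random x only),
   and sink values (relevant for sinks only). *)
Record game (R : realType) (V : finType) := Game {
  kind : V -> vkind;
  arc  : rel V;
  prob : V -> V -> R;
  sval : V -> R }.

Section Games.
Variables (R : realType) (V : finType) (G : game R V).

Definition is_max  x := if kind G x is VMax  then true else false.
Definition is_min  x := if kind G x is VMin  then true else false.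
Definition is_rand x := if kind G x is VRand then true else false.
Definition is_sink x := if kind G x is VSink then true else false.

Definition is_rat (c : R) := exists r : rat, c = ratr r.

Definition is_SSG : Prop :=
  (exists x, is_sink x) /\
  (forall x, ~~ is_sink x -> exists y, arc G x y) /\
  (forall x, is_sink x -> forall y, arc G x y = (y == x)) /\
  (forall x, is_rand x ->
     (forall y, arc G x y -> 0 < prob G x y) /\
     (forall y, ~~ arc G x y -> prob G x y = 0) /\
     (\sum_(y : V) prob G x y = 1) /\
     (forall y, is_rat (prob G x y))) /\
  (forall x, is_sink x -> 0 <= sval G x <= 1 /\ is_rat (sval G x)).

Definition is_qSSG (q : nat) : Prop :=
  is_SSG /\
  #|[set x | is_sink x]| = 2%N /\
  (exists x0 x1, is_sink x0 /\ is_sink x1 /\ sval G x0 = 0 /\ sval G x1 = 1) /\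
  (forall x, is_rand x -> exists qx : nat, (1 <= qx <= q)%N /\
     forall y, exists l : nat, prob G x y = l%:R / qx%:R).

(* Positional strategies (values at vertices of the other kinds are irrelevant). *)
Definition max_strat (s : {ffun V -> V}) := forall x, is_max x -> arc G x (s x).
Definition min_strat (t : {ffun V -> V}) := forall x, is_min x -> arc G x (t x).

(* vk s t k x = expected value of the play from x under (s,t) counted if a
   sink is reached within k steps (= E[Val(X_k); X_k is a sink]). *)
Fixpoint vk (s t : {ffun V -> V}) (k : nat) (x : V) : R :=
  match k with
  | 0%N => if is_sink x then sval G x else 0
  | k'.+1 => match kind G x with
             | VSink => sval G x
             | VMax => vk s t k' (s x)
             | VMin => vk s t k' (t x)
             | VRand => \sum_(y : V) prob G x y * vk s t k' y
             end
  end.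

(* v_{s,t}(x): expectation of the play value (value of the sink reached,
   0 if none), i.e. the limit of the k-step truncations. *)
Definition value (s t : {ffun V -> V}) (x : V) : R := limn (fun k => vk s t k x).

Definition best_response (s t : {ffun V -> V}) : Prop :=
  min_strat t /\ forall t', min_strat t' -> forall x, value s t x <= value s t' x.

Definition tau (s : {ffun V -> V}) : {ffun V -> V} :=
  xget [ffun x => x] (best_response s).

Definition vsig (s : {ffun V -> V}) : V -> R := value s (tau s).

Definition optimal (s t : {ffun V -> V}) : Prop :=
  max_strat s /\
  (forall s', max_strat s' -> forall x, vsig s' x <= vsig s x) /\
  best_response s t.

End Games.

Section Transform.
Variables (R : realType) (V : finType) (G : game R V).

(* Vertex type of G[A,sigma]: vertices of G plus one new sink s_e per e in A. *)
Definition tvert (A : {set V * V}) := (V + {e : V * V | e \in A})%type.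

Definition transform (A : {set V * V}) (sigma : {ffun V -> V}) : game R (tvert A) :=
  @Game R (tvert A)
    (fun w => match w with inl x => kind G x | inr _ => VSink end)
    (fun w w' => match w, w' with
                 | inl x, inl y => arc G x y && ((x, y) \notin A)
                 | inl x, inr e => (val e).1 == x
                 | inr e, inr e' => e' == e
                 | inr _, inl _ => false
                 end)
    (fun w w' => match w, w' with
                 | inl x, inl y => if (x, y) \in A then 0 else prob G x y
                 | inl x, inr e => if (val e).1 == x then prob G x (val e).2 else 0
                 | _, _ => 0
                 end)
    (fun w => match w with
              | inl x => sval G x
              | inr e => vsig G sigma (val e).2
              end).

(* Identification of a strategy of G with a strategy of G[A,sigma]:
   choosing y at x becomes choosing s_(x,y) when (x,y) is in A. *)
Definition lift (A : {set V * V}) (s : {ffun V -> V}) : {ffun tvert A -> tvert A} :=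
  [ffun w => match w with
             | inl x => match (insub (x, s x) : option {e : V * V | e \in A}) with
                        | Some e => inr e
                        | None => inl (s x)
                        end
             | inr e => inr e
             end].

Definition succ_tr (A : {set V * V}) (sigma sigma' : {ffun V -> V}) : Prop :=
  let H := transform A sigma in
  (forall x, vsig H (lift A sigma) (inl x) <= vsig H (lift A sigma') (inl x)) /\
  (exists x, vsig H (lift A sigma) (inl x) != vsig H (lift A sigma') (inl x)) /\
  (forall x, is_max G x ->
     vsig H (lift A sigma') (inl x) = vsig H (lift A sigma) (inl x) ->
     sigma' x = sigma x).

(* ss 0, ..., ss k are the strategies of a run of GSIA performing k iterations. *)
Definition gsia_run (ss : nat -> {ffun V -> V}) (k : nat) : Prop :=
  max_strat G (ss 0%N) /\
  forall i, (i < k)%N ->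
    ~ optimal G (ss i) (tau G (ss i)) /\
    exists A : {set V * V},
      (forall e, e \in A -> arc G e.1 e.2) /\
      max_strat G (ss i.+1) /\
      succ_tr A (ss i) (ss i.+1).

End Transform.

(* Main.v *)
Require Import Defs.
From HB Require Import structures.
From mathcomp Require Import all_boot all_order all_algebra.
From mathcomp Require Import boolp classical_sets reals topology normedtype sequences.
From mathcomp Require Import ring.
Set Implicit Arguments. Unset Strict Implicit. Unset Printing Implicit Defensive.
Import Order.TTheory GRing.Theory Num.Theory numFieldNormedType.Exports.
Local Open Scope ring_scope.

(* In any game v_sigma is the least nonnegative fixpoint of the Bellman operator
   of MIN against sigma, and G[A,sigma] only changes this operator by freezing
   the values at the ends of the arcs of A. An argument on the set where the
   difference of two fixpoints is maximal shows that sigma' >_{G[A,sigma]} sigma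
   implies v_sigma' > v_sigma in G itself. If no MAX vertex x satisfied
   v_sigma(sigma'(x)) > v_sigma(x), then v_sigma would be a prefixpoint for
   sigma', contradicting v_sigma' > v_sigma. So some MAX vertex gains at least
   v_sigma(sigma'(x)) - v_sigma(x) > 0. All values of v_sigma are integer
   multiples of 1/d, where d is the determinant of a row diagonally dominant
   matrix with nonpositive off-diagonal entries; such a determinant is at most
   the product of the diagonal entries, here q^r. Hence each iteration increases
   the sum of v_sigma over the n MAX vertices, which lies in [0, n], by at least
   q^-r. *)

(** * Determinants of row diagonally dominant matrices *)

(** Clearing the first column by unipotent row operations leaves the Schur complement. *)
Lemma det_schur (F : fieldType) n (M : 'M[F]_(1 + n)) : M 0 0 != 0 ->
  \det M = M 0 0 * \det (drsubmx M - (M 0 0)^-1 *: (dlsubmx M *m ursubmx M)).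
Proof.
move=> a0; set a := M 0 0; set N := drsubmx M - _.
have aE : ulsubmx M = a%:M.
  apply/matrixP => i j; rewrite !mxE !ord1 eqxx mulr1n.
  by congr (M _ _); apply/val_inj.
have E : block_mx 1%:M 0 (- (a^-1 *: dlsubmx M)) 1%:M *m M
       = block_mx a%:M (ursubmx M) 0 N.
  rewrite -[X in _ *m X = _](submxK M) mulmx_block aE !mul1mx !mul0mx !addr0.
  rewrite mulNmx mulNmx -!scalemxAl mul_mx_scalar scalerA mulVf // scale1r addNr.
  by rewrite addrC.
have := congr1 determinant E.
rewrite det_mulmx det_lblock !det1 !mul1r => ->.
by rewrite det_ublock det_scalar1.
Qed.

Lemma dominant_diag_ge0 (F : realFieldType) n (M : 'M[F]_n) :
  (forall i j, i != j -> M i j <= 0) -> (forall i, 0 <= \sum_j M i j) ->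
  forall i, 0 <= M i i.
Proof.
move=> offd rows i; rewrite (le_trans (rows i)) // (bigD1 i) //= gerDl.
by rewrite sumr_le0 // => j ji; rewrite offd // eq_sym.
Qed.

(** Induction on the size: taking the Schur complement of a positive pivot keeps both hypotheses and
    can only lower the remaining diagonal entries. *)
Lemma det_dominant (F : realFieldType) n (M : 'M[F]_n) :
  (forall i j, i != j -> M i j <= 0) -> (forall i, 0 <= \sum_j M i j) ->
  0 <= \det M <= \prod_i M i i.
Proof.
elim: n M => [|n IH] M offd rows; first by rewrite det_mx00 big_ord0 ler01 lexx.
have dM := dominant_diag_ge0 offd rows.
have [a0|a0] := eqVneq (M 0 0) 0.
  (* With a zero pivot the first row is nonpositive with nonnegative sum, so it vanishes. *)
  have row_le0 j : M 0 j <= 0.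
    by have [->|jn0] := eqVneq j 0; rewrite ?a0 // offd // eq_sym.
  have row0 j : M 0 j = 0.
    apply/eqP; rewrite eq_le row_le0 (le_trans (rows 0)) // (bigD1 j) //= gerDl.
    by rewrite sumr_le0.
  rewrite (expand_det_row _ 0) big1 => [|j _]; last by rewrite row0 mul0r.
  by rewrite lexx prodr_ge0.
have a_gt0 : 0 < M 0 0 by rewrite lt_neqAle eq_sym a0 dM.
rewrite (@det_schur _ n M) // big_ord_recl.
set N := drsubmx _ - _.
have NE i j : N i j = M (lift 0 i) (lift 0 j)
    - (M 0 0)^-1 * (M (lift 0 i) 0 * M 0 (lift 0 j)).
  rewrite !mxE big_ord1 !mxE.
  by congr (M _ _ - _ * (M _ _ * M _ _)); apply/val_inj.
have col_le0 i : M (lift 0 i) 0 <= 0 by apply: offd.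
have row_le0 i : M 0 (lift 0 i) <= 0 by apply: offd.
have corr i j : 0 <= (M 0 0)^-1 * (M (lift 0 i) 0 * M 0 (lift 0 j)).
  by rewrite mulr_ge0 ?invr_ge0 ?dM // mulr_le0.
have offN i j : i != j -> N i j <= 0.
  move=> ij; rewrite NE subr_le0 (le_trans _ (corr i j)) //.
  by apply: offd; rewrite (inj_eq lift_inj).
have rowsN i : 0 <= \sum_j N i j.
  under eq_bigr do rewrite NE.
  rewrite sumrB -mulr_sumr -mulr_sumr.
  have := rows (lift 0 i); rewrite big_ord_recl => ri.
  have := rows 0; rewrite big_ord_recl => r0.
  apply: (le_trans ri); rewrite -subr_ge0.
  set m := M (lift 0 i) _; set S0 := \sum_(j < n) M 0 _; set Si := \sum_(j < n) _.
  (* A row sum of [N] exceeds that of [M] by [- m / M 0 0] times the sum of row 0, which is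
     nonnegative. *)
  have -> : Si - (M 0 0)^-1 * (m * S0) - (m + Si)
          = - m * ((M 0 0)^-1 * (M 0 0 + S0)).
    by field.
  by rewrite mulr_ge0 ?oppr_ge0 ?col_le0 // mulr_ge0 ?invr_ge0.
have /andP[N0 NP] := IH N offN rowsN.
apply/andP; split; first by rewrite mulr_ge0 ?dM.
rewrite ler_pM2l // (le_trans NP) // ler_prod // => i _.
by rewrite (dominant_diag_ge0 offN rowsN) NE gerBl corr.
Qed.

(* MathComp shadows sval, arc and lift of Defs. *)
Import Defs.

(** * Least nonnegative fixpoints *)

(** Endless plays earn 0, so among the possibly many fixpoints of a Bellman operator the value is
    the least. *)
Definition least_fix (R : realType) (T : Type) (F : (T -> R) -> T -> R) (u : T -> R) :=
  [/\ forall x, 0 <= u x, forall x, F u x = u x &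
      forall u', (forall x, 0 <= u' x) -> (forall x, F u' x <= u' x) ->
        forall x, u x <= u' x].

(** Resetting [u] to 0 on [S] yields a nonnegative prefixpoint, which minimality places above
    [u]. *)
Lemma least_fix_zero (R : realType) (T : Type) (F : (T -> R) -> T -> R) (u : T -> R)
    (S : pred T) :
  (forall f g, (forall x, f x <= g x) -> forall x, F f x <= F g x) ->
  least_fix F u ->
  (forall x, S x -> F (fun y => if S y then 0 else u y) x <= 0) ->
  forall x, S x -> u x = 0.
Proof.
move=> Fmono [u0 uE uP] FS x Sx; apply/eqP; rewrite eq_le u0 andbT.
have := uP (fun y => if S y then 0 else u y) _ _ x; rewrite Sx; apply.
  by move=> y; case: ifP.
move=> y; case: ifP => [/FS//|_]; rewrite -[leRHS]uE; apply: Fmono => z.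
by case: ifP.
Qed.

(** * Bellman operators and values of strategies *)

Section Games.
Local Open Scope classical_set_scope.
Variables (R : realType) (V : finType) (G : game R V).
Implicit Types (s t : {ffun V -> V}) (u f g : V -> R).

Definition stept s t f (x : V) : R :=
  match kind G x with
  | VSink => sval G x
  | VMax => f (s x)
  | VMin => f (t x)
  | VRand => \sum_(y : V) prob G x y * f y
  end.

Definition amin f (x : V) : V :=
  [arg min_(y < odflt x [pick y | arc G x y] | arc G x y) f y]%O.

Definition greedy f : {ffun V -> V} := [ffun x => amin f x].

(* The Bellman operator of MIN against the fixed MAX strategy s. *)
Definition step s f : V -> R := stept s (greedy f) f.

(** What the fixpoint theory uses of a game, isolated so that it covers [G] and [G[A,sigma]]
    alike. *)
Definition tame : Prop :=
  [/\ forall x, is_min G x -> exists y, arc G x y,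
      forall x y, is_rand G x -> 0 <= prob G x y,
      forall x, is_rand G x -> \sum_y prob G x y <= 1 &
      forall x, is_sink G x -> 0 <= sval G x <= 1].

Hypothesis tG : tame.

Lemma aminP f x : is_min G x ->
  arc G x (amin f x) /\ forall y, arc G x y -> f (amin f x) <= f y.
Proof.
case: tG => [out _ _ _] /out [y xy]; rewrite /amin; case: arg_minP => /=.
  by case: pickP => [//|/(_ y)]; rewrite xy.
by move=> z xz zP.
Qed.

Lemma min_strat_greedy f : min_strat G (greedy f).
Proof. by move=> x /(aminP f)[]; rewrite ffunE. Qed.

Lemma le_stept s t f g :
  (forall x, f x <= g x) -> forall x, stept s t f x <= stept s t g x.
Proof.
case: tG => [_ p0 _ _] fg x; have := p0 x; rewrite /stept /is_rand.
by case: (kind G x) => // p0x; apply: ler_sum => y _; rewrite ler_wpM2l ?p0x.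
Qed.

Lemma step_le s t f : min_strat G t -> forall x, step s f x <= stept s t f x.
Proof.
move=> ht x; have := ht x; have := @aminP f x; rewrite /step /stept /is_min.
by case: (kind G x) => // /(_ isT)[_ fP] /(_ isT)/fP; rewrite ffunE.
Qed.

Lemma le_step s f g :
  (forall x, f x <= g x) -> forall x, step s f x <= step s g x.
Proof.
move=> fg x; apply: le_trans (step_le _ _ (min_strat_greedy g) x) _.
exact: le_stept.
Qed.

Lemma stept_ge0 s t f : (forall x, 0 <= f x) -> forall x, 0 <= stept s t f x.
Proof.
case: tG => [_ p0 _ sv] f0 x; have := p0 x; have := sv x.
rewrite /stept /is_rand /is_sink; case: (kind G x) => // [_|/(_ isT)/andP[]//] p0x.
by apply: sumr_ge0 => y _; rewrite mulr_ge0 ?p0x.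
Qed.

Lemma stept_le1 s t x : stept s t (fun=> 1) x <= 1.
Proof.
case: tG => [_ p0 p1 sv]; have := p1 x; have := sv x.
rewrite /stept /is_rand /is_sink; case: (kind G x) => // [_|/(_ isT)/andP[]//] /(_ isT).
by under [X in _ -> X <= _]eq_bigr do rewrite mulr1.
Qed.

Lemma vkS s t k x : vk G s t k.+1 x = stept s t (vk G s t k) x.
Proof. by rewrite /= /stept; case: (kind G x). Qed.

Lemma vk_ge0 s t k x : 0 <= vk G s t k x.
Proof.
elim: k x => [|k IH] x; last by rewrite vkS stept_ge0.
by case: tG => [_ _ _ sv] /=; case: ifP => // /sv/andP[].
Qed.

Lemma vk_le s t u : (forall x, 0 <= u x) -> (forall x, stept s t u x <= u x) ->
  forall k x, vk G s t k x <= u x.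
Proof.
move=> u0 ule; elim=> [|k IH] x /=.
  have := ule x; rewrite /stept /is_sink.
  by case: (kind G x) => // _; apply: u0.
by rewrite -/(vk G s t k.+1 x) vkS (le_trans (le_stept _ _ IH x)).
Qed.

Lemma vk_nondecr s t x : nondecreasing_seq (fun k => vk G s t k x).
Proof.
apply/nondecreasing_seqP => k; elim: k x => [|k IH] x; last first.
  by rewrite vkS [leRHS]vkS; apply: le_stept.
rewrite vkS /= /is_sink /stept; have := @stept_ge0 s t (vk G s t 0) (vk_ge0 s t 0) x.
by rewrite /stept; case: (kind G x).
Qed.

Lemma vk_cvg s t x : cvgn (fun k => vk G s t k x).
Proof.
apply: nondecreasing_is_cvgn; first exact: vk_nondecr.
exists 1 => _ [k _ <-]; apply: (vk_le (u := fun=> 1)) => // y.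
exact: stept_le1.
Qed.

Lemma value_least_fix s t : least_fix (stept s t) (value G s t).
Proof.
split=> [x|x|u u0 ule x].
- apply: limr_ge; first exact: vk_cvg.
  by near=> k; apply: vk_ge0.
(* The shifted truncations tend both to the value and, [stept] being continuous, to its image under
   [stept]. *)
- have cS : (fun k => vk G s t k.+1 x) @ \oo --> value G s t x.
    by rewrite (cvg_shiftS (fun k => vk G s t k x)); apply: vk_cvg.
  apply: (cvg_unique _ _ cS) => //.
  rewrite (_ : (fun k => _) = (fun k => stept s t (vk G s t k) x)); last first.
    by apply/funext => k; rewrite vkS.
  rewrite /stept; case: (kind G x).
  + exact: vk_cvg.
  + exact: vk_cvg.
  + apply: cvg_big => [|y _]; first exact: add_continuous.
    by apply: cvgMr; apply: vk_cvg.
  + exact: cvg_cst.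
- apply: limr_le; first exact: vk_cvg.
  by near=> k; apply: vk_le.
Unshelve. all: by end_near. Qed.

(** Knaster-Tarski: [w] is the infimum of the nonnegative prefixpoints. The greedy MIN strategy for
    [w] attains [w] and no MIN strategy goes below it, so a best response exists and has value
    [w]. *)
Lemma vsig_least_fix s : least_fix (step s) (vsig G s).
Proof.
pose P := [set u : V -> R | (forall x, 0 <= u x) /\ (forall x, step s u x <= u x)].
pose w x := inf [set u x | u in P].
have lbP x : has_lbound [set u x | u in P].
  by exists 0 => _ [u [u0 _] <-].
have P1 : P (fun=> 1) by split=> // x; apply: stept_le1.
have w_le u x : P u -> w x <= u x by move=> Pu; apply: ge_inf => //; exists u.
have w_ge c x : (forall u, P u -> c <= u x) -> c <= w x.
  move=> cP; apply: lb_le_inf; first by exists 1, (fun=> 1).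
  by move=> _ [u Pu <-]; apply: cP.
have w0 x : 0 <= w x by apply: w_ge => u [].
have wle x : step s w x <= w x.
  apply: w_ge => u Pu; have [_ uP] := Pu; apply: le_trans (uP x).
  by apply: le_step => y; apply: w_le.
have wE x : step s w x = w x.
  apply/eqP; rewrite eq_le wle; apply: w_le; split; first exact: stept_ge0.
  by move=> y; apply: le_step.
have ht := min_strat_greedy w.
have wfix : least_fix (step s) w by split=> // u u0 uP x; apply: w_le.
have vle x : value G s (greedy w) x <= w x.
  by have [_ _] := value_least_fix s (greedy w); apply=> // y; rewrite wE.
have lev t x : min_strat G t -> w x <= value G s t x.
  move=> tm; have [v0 vE _] := value_least_fix s t.
  by apply: w_le; split=> // y; rewrite -[leRHS]vE step_le.
have br : best_response G s (greedy w).
  by split=> // t tm x; apply: le_trans (lev t x tm).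
have [tm tP] : best_response G s (tau G s) by apply: (xgetPex _ (ex_intro _ _ br)).
suff -> : vsig G s = w by [].
apply/funext => x; apply/eqP; rewrite eq_le lev // andbT.
exact: le_trans (tP _ ht x) (vle x).
Qed.

Lemma vsig_le1 s x : vsig G s x <= 1.
Proof.
have [_ _] := vsig_least_fix s.
by apply=> // y; apply: stept_le1.
Qed.

End Games.

(* [redirect A c x u] lists the values found at the ends of the arcs leaving x
   in G[A,sigma] when u is the vector of values on G and c = v_sigma. *)
Definition redirect (R : realType) (V : finType) (A : {set V * V}) (c : V -> R)
    (x : V) (u : V -> R) (y : V) : R :=
  if (x, y) \in A then c y else u y.

(** * Values in the transformed game *)

Section Transform.
Variables (R : realType) (V : finType) (G : game R V) (tG : tame G).
Variables (A : {set V * V}) (sigma : {ffun V -> V}).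
Hypothesis Aarc : forall e, e \in A -> arc G e.1 e.2.
Local Notation v := (vsig G sigma).
Local Notation H := (transform G A sigma).
Implicit Types (s : {ffun V -> V}) (u : V -> R).

Definition extend u (w : tvert A) : R :=
  match w with inl y => u y | inr e => v (val e).2 end.

(** [c] is arbitrary so that constant functions also give the total probability in
    [tame_transform]. *)
Lemma sum_transform (c u : V -> R) x :
  \sum_(w : tvert A) prob H (inl x) w *
      (match w with inl y => u y | inr e => c (val e).2 end)
  = \sum_y prob G x y * redirect A c x u y.
Proof.
rewrite big_sumType /=.
pose K (e : V * V) := (if e.1 == x then prob G x e.2 else 0) * c e.2.
have -> : \sum_(e : {e : V * V | e \in A}) K (val e)
        = \sum_y if (x, y) \in A then prob G x y * c y else 0.
  rewrite -(big_sub (op := +%R) A K) big_mkcond /=.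
  transitivity (\sum_a \sum_b if (a, b) \in A then K (a, b) else 0).
    by rewrite pair_bigA; apply: eq_bigr => -[].
  rewrite (bigD1 x) //= [X in _ + X]big1 ?addr0 => [|a /negPf ax].
    by apply: eq_bigr => b _; rewrite /K eqxx.
  by apply: big1 => b _; rewrite /K /= ax mul0r if_same.
rewrite -big_split; apply: eq_bigr => y _ /=.
by rewrite /redirect; case: ifP; rewrite ?mul0r ?add0r ?addr0.
Qed.

Lemma tame_transform : tame H.
Proof.
have [out p0 p1 sv] := tG; split.
- case=> [x|//] /(out x)[y xy] /=.
  case xyA: ((x, y) \in A); first by exists (inr (exist _ (x, y) xyA)) => /=.
  by exists (inl y); rewrite xy xyA.
- by case=> [x|//] [y|e] /(p0 x) px /=; case: ifP.
- case=> [x|//] xr.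
  rewrite (eq_bigr (fun w => prob H (inl x) w *
      (match w with inl _ => 1 | inr _ => 1 end))); last first.
    by case=> [y|e] _; rewrite mulr1.
  rewrite (sum_transform (fun=> 1) (fun=> 1)).
  under eq_bigr do rewrite /redirect if_same mulr1.
  exact: p1.
- case=> [x|e] /=; first exact: (sv x).
  have [v0 _ _] := vsig_least_fix tG sigma.
  by rewrite v0 vsig_le1.
Qed.

(** At a MIN vertex both minima range over the same values: [Aarc] makes every new sink come from a
    genuine arc of [G]. *)
Lemma step_transform s u x :
  step H (lift A s) (extend u) (inl x) = step G s (redirect A v x u) x.
Proof.
have := @aminP _ _ _ tG (redirect A v x u) x.
have := @aminP _ _ _ tame_transform (extend u) (inl x).
rewrite /step /stept /is_min /=; case: (kind G x) => //.
- move=> _ _; rewrite ffunE; case: insubP => [e xA /= ->|/negPf xA /=].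
    by rewrite /redirect xA.
  by rewrite /redirect xA.
- move=> /(_ isT)[a1 a2] /(_ isT)[b1 b2]; rewrite !ffunE.
  apply/eqP; rewrite eq_le; apply/andP; split.
    set y := amin G _ _ in b1 b2 *.
    rewrite /redirect; case: ifP => xyA.
      exact: (a2 (inr (exist _ (x, y) xyA))).
    by apply: (a2 (inl y)); rewrite b1 xyA.
  case: (amin H _ _) a1 {a2} => [y /andP[xy /negPf xyA]|[[a y] xyA] /= /eqP ax] /=.
    by have := b2 _ xy; rewrite [X in _ <= X -> _]/redirect xyA.
  by subst a; have := b2 y (Aarc xyA); rewrite [X in _ <= X -> _]/redirect xyA.
- by move=> _ _; rewrite -sum_transform.
Qed.

Lemma vsig_transform_least_fix s :
  least_fix (fun u x => step G s (redirect A v x u) x)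
            (fun x => vsig H (lift A s) (inl x)).
Proof.
pose h x := vsig H (lift A s) (inl x).
have [h0 hE hP] := vsig_least_fix tame_transform (lift A s).
have hext : vsig H (lift A s) = extend h.
  by apply/funext => -[x|e] //=; rewrite -hE.
have [v0 vE _] := vsig_least_fix tG sigma.
split=> [x|x|u u0 uP x]; first exact: h0.
  by rewrite -step_transform -hext hE.
apply: (hP (extend u) _ _ (inl x)) => -[y|e] //=; by rewrite step_transform.
Qed.

Lemma vsig_transform_self x : vsig H (lift A sigma) (inl x) = v x.
Proof.
have [v0 vE vP] := vsig_least_fix tG sigma.
have [h0 hE hP] := vsig_transform_least_fix sigma.
have hv y : vsig H (lift A sigma) (inl y) <= v y.
  apply: (hP v) => // z; rewrite (_ : redirect A v z v = v) ?vE //.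
  by apply/funext => w; rewrite /redirect if_same.
apply/eqP; rewrite eq_le hv /=.
apply: (vP (fun y => vsig H (lift A sigma) (inl y))) => // y; rewrite -[leRHS]hE.
by apply: (le_step tG) => z; rewrite /redirect; case: ifP.
Qed.

End Transform.

(** * Improvement in the transformed game carries over to [G] *)

Section Improvement.
Variables (R : realType) (V : finType) (G : game R V) (sG : is_SSG G).
Implicit Types (s t sigma : {ffun V -> V}) (u f g : V -> R) (A : {set V * V}).

Lemma tame_SSG : tame G.
Proof.
have [_ [out [_ [rd sk]]]] := sG; split.
- move=> x xm; apply: out; move: xm; rewrite /is_min /is_sink.
  by case: (kind G x).
- move=> x y /rd[pos [zero _]]; case xy: (arc G x y); first exact/ltW/pos.
  by rewrite zero ?xy.
- by move=> x /rd[_ [_ [-> _]]].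
- by move=> x /sk[].
Qed.

Definition trans s t (x y : V) : R :=
  match kind G x with
  | VMax => (y == s x)%:R
  | VMin => (y == t x)%:R
  | VRand => prob G x y
  | VSink => 0
  end.

Lemma trans_ge0 s t x y : 0 <= trans s t x y.
Proof.
have [_ p0 _ _] := tame_SSG; have := p0 x y; rewrite /trans /is_rand.
by case: (kind G x) => // /(_ isT).
Qed.

Lemma sum_trans s t x : ~~ is_sink G x -> \sum_y trans s t x y = 1.
Proof.
have dirac z : \sum_y (y == z)%:R = 1 :> R.
  by rewrite (bigD1 z) //= eqxx big1 ?addr0 // => y /negPf ->.
have [_ [_ [_ [rd _]]]] := sG; have := rd x; rewrite /trans /is_rand /is_sink.
by case: (kind G x) => // /(_ isT)[_ [_ []]].
Qed.

Lemma stept_trans s t f x : ~~ is_sink G x ->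
  stept G s t f x = \sum_y trans s t x y * f y.
Proof.
have dirac z : f z = \sum_y (y == z)%:R * f y.
  rewrite (bigD1 z) //= eqxx mul1r big1 ?addr0 // => y /negPf ->.
  by rewrite mul0r.
by rewrite /stept /trans /is_sink; case: (kind G x).
Qed.

(** Maximum principle: the nonnegative terms weighting [d - f] sum to 0, so each vanishes. *)
Lemma trans_max s t f (d : R) x : ~~ is_sink G x ->
  (forall y, 0 < trans s t x y -> f y <= d) ->
  d <= \sum_y trans s t x y * f y ->
  forall y, 0 < trans s t x y -> f y = d.
Proof.
move=> xs fd df y ty.
have pos z : 0 <= trans s t x z * (d - f z).
  have := trans_ge0 s t x z; rewrite le_eqVlt => /orP[/eqP <-|tz].
    by rewrite mul0r.
  by rewrite mulr_ge0 ?trans_ge0 // subr_ge0 fd.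
have : \sum_z trans s t x z * (d - f z) = 0.
  apply/eqP; rewrite eq_le sumr_ge0 ?andbT //.
  under eq_bigr do rewrite mulrBr.
  by rewrite sumrB -mulr_suml sum_trans // mul1r subr_le0.
move/psumr_eq0P => /(_ (fun z _ => pos z) y isT)/eqP.
by rewrite mulf_eq0 gt_eqF //= subr_eq0 => /eqP ->.
Qed.

(* A play that never meets a sink nor an arc of A yields nothing. *)
Lemma least_fix_closed s t A (c u : V -> R) (S : pred V) :
  min_strat G t ->
  least_fix (fun u x => step G s (redirect A c x u) x) u ->
  (forall x, S x -> ~~ is_sink G x) ->
  (forall x y, S x -> 0 < trans s t x y -> S y && ((x, y) \notin A)) ->
  forall x, S x -> u x = 0.
Proof.
move=> tm ulf Ssink Scl; apply: (least_fix_zero _ ulf) => [f g fg x|x Sx].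
  apply: (le_step tame_SSG) => y; rewrite /redirect.
  by case: ifP.
apply: le_trans (step_le tame_SSG _ _ tm x) _.
rewrite stept_trans ?Ssink // sumr_le0 // => y _.
have := trans_ge0 s t x y; rewrite le_eqVlt => /orP[/eqP <-|].
  by rewrite mul0r.
by move=> /(Scl _ _ Sx)/andP[Sy /negPf xyA]; rewrite /redirect xyA Sy mulr0.
Qed.

Lemma redirect0 s c :
  (fun u x => step G s (redirect finset.set0 c x u) x) = step G s.
Proof.
apply/funext => u; apply/funext => x; congr (step G s _ x).
by apply/funext => y; rewrite /redirect finset.in_set0.
Qed.

(* If u exceeds w somewhere, the set S where u - w is maximal is closed under
   (s', t) for a suitable t, whence w = 0 and u is constant on S; where v = u on
   S, s and s' agree, so that set is closed under (s, t), has v = 0 and is empty.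
   Hence S uses no arc of A, and u = 0 on S as well. *)
Lemma transform_le A s s' u v w :
  least_fix (step G s) v -> least_fix (step G s') w ->
  least_fix (fun u x => step G s' (redirect A v x u) x) u ->
  (forall x, v x <= u x) ->
  (forall x, is_max G x -> u x = v x -> s' x = s x) ->
  forall x, u x <= w x.
Proof.
move=> vlf wlf ulf vu agree x.
have tG := tame_SSG; have [u0 uE uP] := ulf.
have [v0 vE _] := vlf; have [w0 wE _] := wlf.
rewrite -subr_le0; case: (@arg_maxP _ _ _ x predT (fun x => u x - w x) isT).
move=> m _ dmax; apply: (le_trans (dmax x isT)); rewrite leNgt; apply/negP.
set d := u m - w m => d_gt0.
pose S x := u x - w x == d.
(* With [t] greedy for [w], [w] satisfies an equation under [(s', t)] and [u] an inequality, so the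
   maximum principle applies to the difference. *)
pose t := greedy G w; have tm : min_strat G t := min_strat_greedy tG w.
have wt z : stept G s' t w z = w z by rewrite -wE.
have redir_le z y : redirect A v z u y <= u y by rewrite /redirect; case: ifP.
have Ssink z : S z -> ~~ is_sink G z.
  move=> /= /eqP zd; apply/negP => zs; move: d_gt0; rewrite -zd -uE -wE.
  by rewrite /step /stept; move: zs; rewrite /is_sink; case: kind; rewrite ?subrr ?ltxx.
have Sstep z y : S z -> 0 < trans s' t z y ->
    redirect A v z u y = u y /\ S y.
  move=> Sz zy.
  have le_d y' : redirect A v z u y' - w y' <= d.
    by rewrite (le_trans _ (dmax y' isT)) // lerD2r.
  have E : redirect A v z u y - w y = d.
    apply: (trans_max (f := fun y => redirect A v z u y - w y) (Ssink _ Sz)) zy => //.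
    under eq_bigr do rewrite mulrBr.
    rewrite sumrB -!stept_trans ?Ssink // wt -(eqP Sz) lerD2r -[leLHS]uE.
    exact: step_le.
  have E' : redirect A v z u y = u y.
    apply/eqP; rewrite eq_le redir_le -(lerD2r (- w y)) E.
    exact: dmax.
  by split=> //; rewrite /S -E E'.
have w_S : forall z, S z -> w z = 0.
  apply: (@least_fix_closed s' t finset.set0 w w S tm _ Ssink).
    by rewrite redirect0.
  by move=> z y Sz zy; rewrite finset.in_set0 andbT; case: (Sstep z y Sz zy).
have u_S z : S z -> u z = d.
  by move=> Sz; rewrite -(eqP Sz) w_S // subr0.
have v_lt z : S z -> v z != u z.
  move=> Sz; apply/negP => vz.
  pose S' x := S x && (v x == u x).
  have S'sink y : S' y -> ~~ is_sink G y by case/andP => /Ssink.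
  suff /(_ z) : forall z, S' z -> v z = 0.
    by rewrite /S' Sz vz => /(_ isT); rewrite (eqP vz) u_S // => /eqP; rewrite gt_eqF.
  apply: (@least_fix_closed s t finset.set0 v v S' tm _ S'sink).
  - by rewrite redirect0.
  - move=> a b /andP[Sa /eqP va] ab; rewrite finset.in_set0 andbT.
    have same y : trans s t a y = trans s' t a y.
      rewrite /trans; have := agree a; rewrite /is_max.
      by case: (kind G a) => // /(_ isT) ->.
    have SS y : 0 < trans s t a y -> S y.
      by rewrite same => /(Sstep a y Sa)[].
    have Sb := SS _ ab; rewrite /S' Sb u_S //=; apply/eqP.
    apply: (trans_max (s := s) (t := t) (Ssink _ Sa)) ab => [y /SS Sy|].
      by rewrite -(u_S _ Sy).
    rewrite -stept_trans ?Ssink // -(u_S _ Sa) -va -[leLHS]vE.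
    exact: step_le.
(* An arc of [A] used inside [S] would force [v = u] at its end, against [v_lt]. *)
have /(_ m) : forall z, S z -> u z = 0.
  apply: (@least_fix_closed s' t A v u S tm ulf Ssink) => z y Sz zy.
  have [E Sy] := Sstep z y Sz zy; rewrite Sy /=; apply/negP => zyA.
  by move/negP: (v_lt _ Sy); apply; rewrite -E /redirect zyA.
have Sm : S m by rewrite /S.
by move=> /(_ Sm)/eqP; rewrite u_S // gt_eqF.
Qed.

Lemma succ_tr_vsig A sigma sigma' :
  (forall e, e \in A -> arc G e.1 e.2) -> succ_tr G A sigma sigma' ->
  (forall x, vsig G sigma x <= vsig G sigma' x) /\
  (exists x, vsig G sigma x < vsig G sigma' x).
Proof.
move=> Aarc [le_h [[x ne_h] agree]]; have tG := tame_SSG.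
pose u y := vsig (transform G A sigma) (lift A sigma') (inl y).
have vu y : vsig G sigma y <= u y.
  by rewrite -(vsig_transform_self tG sigma Aarc y); apply: le_h.
have uw : forall y, u y <= vsig G sigma' y.
  have vlf := vsig_least_fix tG sigma; have wlf := vsig_least_fix tG sigma'.
  have ulf := vsig_transform_least_fix tG sigma Aarc sigma'.
  apply: (transform_le vlf wlf ulf vu) => y ym uy.
  apply: (agree y ym); rewrite (vsig_transform_self tG sigma Aarc y).
  exact: uy.
split=> [y|]; first exact: le_trans (vu y) (uw y).
exists x; apply: lt_le_trans (uw x).
rewrite lt_neqAle vu andbT -(vsig_transform_self tG sigma Aarc x).
exact: ne_h.
Qed.

(** The gain passes through [v (s' x)] so that it is bounded below by a difference of two entries of
    the same vector [v]; these share a denominator, while [v x] and [w x] need not. *)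
Lemma least_fix_gain s s' v w :
  least_fix (step G s) v -> least_fix (step G s') w ->
  (forall x, v x <= w x) -> (exists x, v x < w x) ->
  exists2 x, is_max G x & v x < v (s' x) <= w x.
Proof.
move=> [v0 vE _] [w0 wE wP] vw [x0 lt_v].
have [/existsP[x /andP[xm gain]]|/existsPn none] :=
  boolP [exists x, is_max G x && (v x < v (s' x))].
  exists x => //; rewrite gain /= -[leRHS]wE /step /stept.
  by move: xm; rewrite /is_max; case: (kind G x).
suff vP x : step G s' v x <= v x by have := wP v v0 vP x0; rewrite leNgt lt_v.
rewrite -[leRHS]vE; have := none x; have := vE x.
rewrite /is_max /step /stept.
by case: (kind G x) => //= ->; rewrite -leNgt.
Qed.

Lemma succ_tr_gain A sigma sigma' :
  (forall e, e \in A -> arc G e.1 e.2) -> succ_tr G A sigma sigma' ->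
  (forall x, vsig G sigma x <= vsig G sigma' x) /\
  exists2 x, is_max G x &
    vsig G sigma x < vsig G sigma (sigma' x) <= vsig G sigma' x.
Proof.
move=> Aarc sc; have [le_v lt_v] := succ_tr_vsig Aarc sc.
have tG := tame_SSG; split; first exact: le_v.
have vlf := vsig_least_fix tG sigma; have wlf := vsig_least_fix tG sigma'.
exact: least_fix_gain vlf wlf le_v lt_v.
Qed.

End Improvement.

(** * A common denominator for the values *)

Section Denominator.
Variables (R : realType) (V : finType) (G : game R V) (q : nat).
Hypothesis qG : is_qSSG G q.
Variables (s t : {ffun V -> V}).
Local Notation v := (value G s t).
Local Notation r := #|[set x | is_rand G x]|.

Let sG : is_SSG G. Proof. by case: qG. Qed.

(** Rows of non-random vertices get denominator 1, so only the [r] random ones contribute a factor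
    [q]. *)
Lemma trans_rational : exists QL : V -> nat * (V -> nat), forall x,
  [/\ (0 < (QL x).1 <= if is_rand G x then q else 1)%N &
      forall y, (QL x).1%:R * trans G s t x y = ((QL x).2 y)%:R].
Proof.
suff /boolp.choice[QL] : forall x, exists ql : nat * (V -> nat),
    (0 < ql.1 <= if is_rand G x then q else 1)%N /\
    forall y, ql.1%:R * trans G s t x y = (ql.2 y)%:R by exists QL.
move=> x; have [_ [_ [_ rat]]] := qG; have := rat x.
rewrite /is_rand /trans; case: (kind G x) => [_|_|/(_ isT)[d [/andP[d0 dq] lP]]|_].
- by exists (1%N, fun y => nat_of_bool (y == s x)); split=> // y; rewrite mul1r.
- by exists (1%N, fun y => nat_of_bool (y == t x)); split=> // y; rewrite mul1r.
- have [l lE] := boolp.choice lP; exists (d, l); split=> [|y] /=; first by rewrite d0.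
  by rewrite lE mulrC divfK // pnatr_eq0 -lt0n.
- by exists (1%N, fun y => 0%N); split=> // y; rewrite mulr0.
Qed.

Lemma sval_sink x : is_sink G x -> sval G x = (sval G x == 1)%:R.
Proof.
have [_ [c2 [[x0 [x1 [s0 [s1 [v0 v1]]]]] _]]] := qG; move=> xs.
have ne : x0 != x1.
  by apply/eqP => E; move/eqP: v1; rewrite -E v0 eq_sym oner_eq0.
have : x \in [set y | is_sink G y] by rewrite inE.
have <- : [set x0; x1] = [set y | is_sink G y].
  apply/eqP; rewrite eqEcard c2 cards2 ne leqnn andbT.
  by apply/fintype.subsetP => y; rewrite !inE => /orP[] /eqP ->.
by rewrite !inE => /orP[] /eqP ->; rewrite ?v0 ?v1 ?eqxx // eq_sym oner_eq0.
Qed.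

(* A harmonic function vanishing where the play stops or yields nothing cannot
   be positive: its argmax set would be closed, hence of value 0. *)
Lemma harmonic_le0 (g : V -> R) :
  (forall x, is_sink G x || (v x == 0) -> g x = 0) ->
  (forall x, ~~ (is_sink G x || (v x == 0)) ->
     g x = \sum_y trans G s t x y * g y) ->
  forall x, g x <= 0.
Proof.
move=> g0 gE x; have tG := tame_SSG sG.
case: (@arg_maxP _ _ _ x predT g isT) => m _ dmax.
apply: (le_trans (dmax x isT)); rewrite leNgt; apply/negP => d_gt0.
pose S x := g x == g m.
have Sstop z : S z -> ~~ (is_sink G z || (v z == 0)).
  by move=> /eqP Sz; apply/negP => /g0 z0; rewrite -Sz z0 ltxx in d_gt0.
have Ssink z : S z -> ~~ is_sink G z.
  by move=> /Sstop; rewrite negb_or => /andP[].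
have : v m = 0.
  apply: (least_fix_zero (S := S) (le_stept tG s t) (value_least_fix tG s t)).
    move=> z Sz; rewrite stept_trans ?Ssink // sumr_le0 // => y _.
    have := trans_ge0 sG s t z y; rewrite le_eqVlt => /orP[/eqP <-|zy].
      by rewrite mul0r.
    have Sy : S y.
      apply/eqP; apply: (trans_max sG (f := g) (Ssink _ Sz)) zy => [y' _|].
        exact: dmax.
      by rewrite -gE ?Sstop // (eqP Sz).
    by rewrite Sy mulr0.
  exact: eqxx.
by have := Sstop m (eqxx _); rewrite negb_or => /andP[_ /eqP].
Qed.

(* By Cramer's rule the values are multiples of 1 / det M, where M is the
   integer matrix of the system satisfied by the values, each row being scaled
   by the denominator of its probabilities. *)
Lemma value_common_denominator : exists2 d : R, 0 < d <= (q ^ r)%:R &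
  forall x, exists a : int, d * v x = a%:~R.
Proof.
have [QL QLP] := trans_rational; have tG := tame_SSG sG.
have [v0 vE _] := value_least_fix tG s t.
pose Q x := (QL x).1; pose L x := (QL x).2.
have Q0 x : (Q x)%:R != 0 :> R.
  by rewrite pnatr_eq0 -lt0n; have [/andP[]] := QLP x.
have LE x y : (L x y)%:R = (Q x)%:R * trans G s t x y :> R.
  by have [_ ->] := QLP x.
(* Trivial equations at vertices of value 0 keep the system nonsingular: a cycle that never reaches
   a sink would make it singular. *)
pose stop x := is_sink G x || (v x == 0).
pose K x y : int := if stop x then (x == y)%:R
                    else (x == y)%:R * (Q x)%:Z - (L x y)%:Z.
pose b x : int := if is_sink G x then (sval G x == 1)%:R else 0.
pose Mi := \matrix_(i < #|V|, j < #|V|) K (enum_val i) (enum_val j).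
pose M : 'M[R]_#|V| := map_mx intr Mi.
have sumV (f : V -> R) : \sum_(j < #|V|) f (enum_val j) = \sum_y f y.
  by rewrite [RHS](reindex _ (onW_bij _ (@enum_val_bij V))).
have dirac x f : \sum_y (x == y)%:R * f y = f x :> R.
  rewrite (bigD1 x) //= eqxx mul1r big1 ?addr0 // => y.
  by rewrite eq_sym => /negPf ->; rewrite mul0r.
have Kstop x f : stop x -> \sum_y (K x y)%:~R * f y = f x :> R.
  move=> xs; rewrite -[RHS]dirac; apply: eq_bigr => y _.
  by rewrite /K xs; case: (x == y).
have Krun x f : ~~ stop x -> \sum_y (K x y)%:~R * f y
    = (Q x)%:R * (f x - \sum_y trans G s t x y * f y) :> R.
  move=> /negPf xs; rewrite -[f x in RHS]dirac -sumrB mulr_sumr.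
  apply: eq_bigr => y _; rewrite /K xs mulrBr mulrA.
  rewrite rmorphB rmorphM /= -!pmulrn LE; case: (x == y); ring.
have Mf f i : \sum_j M i j * f (enum_val j)
    = \sum_y (K (enum_val i) y)%:~R * f y.
  by rewrite -sumV; apply: eq_bigr => j _; rewrite !mxE.
have run_sink x : ~~ stop x -> ~~ is_sink G x.
  by rewrite negb_or => /andP[].
have vb x : \sum_y (K x y)%:~R * v y = (b x)%:~R.
  have [xs|xs] := boolP (stop x).
    rewrite Kstop // /b; have [xk|/negPf xk] := boolP (is_sink G x).
      have -> : v x = sval G x.
        by rewrite -vE /stept; move: xk; rewrite /is_sink; case: (kind G x).
      by rewrite {1}(sval_sink xk); case: (_ == _).
    by move: xs; rewrite /stop xk /= => /eqP ->.
  rewrite Krun // -stept_trans ?run_sink // vE subrr mulr0 /b.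
  by rewrite (negPf (run_sink _ xs)).
(* A self-loop can only lower the diagonal entry below the scaling factor [Q x]. *)
have diagK x : (K x x)%:~R <= (if is_rand G x then q else 1)%:R :> R.
  have [/andP[_ Qle] _] := QLP x; rewrite /K eqxx.
  have one : 1 <= (if is_rand G x then q else 1)%:R :> R.
    by rewrite ler1n; apply: leq_trans Qle; have [/andP[]] := QLP x.
  case: ifP => // _; rewrite mul1r rmorphB /= -!pmulrn.
  by rewrite (@le_trans _ _ (Q x)%:R) ?ler_nat // gerBl ler0n.
have offM i j : i != j -> M i j <= 0.
  move=> ij; rewrite !mxE /K (inj_eq enum_val_inj) (negPf ij); case: ifP => // _.
  by rewrite mul0r sub0r rmorphN /= oppr_le0 -pmulrn ler0n.
have rowsM i : 0 <= \sum_j M i j.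
  have := Mf (fun=> 1) i; under eq_bigr do rewrite mulr1; move=> ->.
  have [xs|xs] := boolP (stop (enum_val i)); first by rewrite Kstop.
  rewrite Krun //; under eq_bigr do rewrite mulr1.
  by rewrite sum_trans ?run_sink // subrr mulr0.
have /andP[d_ge0 d_le] := det_dominant offM rowsM.
have d_ne0 : \det M != 0.
  (* A kernel vector [g] is harmonic and 0 on [stop]; [harmonic_le0] for [g] and [- g] makes it
     vanish. *)
  rewrite -det_tr; apply/negP => /det0P[u u0 uM].
  pose g y := u 0 (enum_rank y).
  have gK x : \sum_y (K x y)%:~R * g y = 0.
    have := congr1 (fun A : 'rV_#|V| => A 0 (enum_rank x)) uM.
    rewrite !mxE => uMx; have := Mf g (enum_rank x).
    rewrite enum_rankK => <-; apply: etrans uMx.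
    by apply: eq_bigr => j _; rewrite !mxE /g enum_valK mulrC.
  have gstop x : stop x -> g x = 0 by move=> xs; rewrite -(gK x) Kstop.
  have grun x : ~~ stop x -> g x = \sum_y trans G s t x y * g y.
    move=> xs; have := gK x; rewrite Krun // => /eqP.
    by rewrite mulf_eq0 (negPf (Q0 x)) subr_eq0 => /eqP.
  have g_le0 y : g y <= 0 := harmonic_le0 gstop grun y.
  have g_ge0 y : - g y <= 0.
    move: y; apply: harmonic_le0 => x xs; first by rewrite gstop ?oppr0.
    by rewrite grun // -sumrN; apply: eq_bigr => y _; rewrite mulrN.
  case/eqP: u0; apply/rowP => j; rewrite mxE -(enum_valK j).
  by apply/eqP; rewrite eq_le g_le0 -oppr_le0 g_ge0.
exists (\det M).
  rewrite lt_neqAle eq_sym d_ne0 d_ge0 (le_trans d_le) //.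
  have -> : (q ^ r)%:R = \prod_x (if is_rand G x then q else 1)%:R :> R.
    rewrite -natr_prod -big_mkcond /= prod_nat_const; congr (_ ^ _)%:R.
    by apply: eq_card => x; rewrite inE.
  rewrite [leRHS](reindex _ (onW_bij _ (@enum_val_bij V))).
  apply: ler_prod => i _; rewrite (dominant_diag_ge0 offM rowsM) !mxE.
  exact: diagK.
move=> x; pose c : 'cV[R]_#|V| := \col_i v (enum_val i).
pose bi : 'cV[int]_#|V| := \col_i b (enum_val i).
have Mc : M *m c = map_mx intr bi.
  apply/colP => i; rewrite !mxE -vb -Mf; apply: eq_bigr => j _.
  by rewrite [c _ _]mxE.
(* Cramer's numerator is an integer because the adjugate is taken over [int]. *)
exists ((\adj Mi *m bi) (enum_rank x) 0).
have := congr1 (mulmx (\adj M)) Mc.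
rewrite mulmxA mul_adj_mx mul_scalar_mx -map_mx_adj -map_mxM.
by move/colP => /(_ (enum_rank x)); rewrite !mxE enum_rankK.
Qed.

(** Multiplied by the common denominator, the difference is a positive integer. *)
Lemma value_gap x y : v x < v y -> 1 <= (q ^ r)%:R * (v y - v x).
Proof.
move=> xy; have [d /andP[d0 dq] dP] := value_common_denominator.
have [a aE] := dP x; have [c cE] := dP y.
apply: (@le_trans _ _ (d * (v y - v x))); last first.
  by rewrite ler_wpM2r // subr_ge0 ltW.
have : 0 < d * (v y - v x) by rewrite mulr_gt0 // subr_gt0.
by rewrite mulrBr aE cE -rmorphB /= ltr0z ler1z.
Qed.

End Denominator.

(** * Counting iterations with a potential *)

Theorem theorem26 (R : realType) (V : finType) (G : game R V) (q : nat) :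
  is_qSSG G q ->
  forall (ss : nat -> {ffun V -> V}) (k : nat),
    gsia_run G ss k ->
    (k <= #|[set x | is_max G x]| * q ^ #|[set x | is_rand G x]|)%N.
Proof.
move=> qG ss k [_ run]; have sG : is_SSG G by case: qG.
have tG := tame_SSG sG; set N := (q ^ _)%N.
have pot i : (i <= k)%N ->
    i%:R <= N%:R * \sum_(x | is_max G x) vsig G (ss i) x.
  elim: i => [|i IH] ik.
    rewrite mulr_ge0 ?ler0n // sumr_ge0 // => x _.
    by have [v0 _ _] := vsig_least_fix tG (ss 0%N); apply: v0.
  have [_ [A [Aarc [_ sc]]]] := run i ik.
  have [le_v [x xm /andP[lt_v gain]]] := succ_tr_gain sG Aarc sc.
  have gap : 1 <= N%:R * (vsig G (ss i) (ss i.+1 x) - vsig G (ss i) x) :=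
    value_gap qG lt_v.
  (* The vertex [x] alone supplies the unit increase; the other terms do not decrease by [le_v]. *)
  rewrite -natr1 (le_trans (lerD (IH (ltnW ik)) gap)) // -mulrDr.
  rewrite ler_wpM2l ?ler0n // (bigD1 x) //= [leRHS](bigD1 x) //=.
  by rewrite [leLHS]addrC addrA subrK lerD // ler_sum.
have := pot k (leqnn k); rewrite -(ler_nat R) => /le_trans; apply.
rewrite mulnC natrM ler_wpM2l ?ler0n //.
apply: (@le_trans _ _ (\sum_(x | is_max G x) 1)).
  by apply: ler_sum => x _; apply: vsig_le1.
rewrite sumr_const ler_nat; apply/eq_leq/eq_card => x.
by rewrite inE.
Qed.
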